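(* Let $\mathbb{K}$ be a field. For any finite simple graph $G$ and for any integer $k\geq 2$, $${\rm reg}(J(G)^{(k)})\leq 2\gamma_0(G)+{\rm reg}(J(G)^{(k-2)}).$$
   Context: For $V(G)=\{x_1,\ldots,x_n\}$, let $S=\mathbb{K}[x_1,\ldots,x_n]$. The cover ideal is $J(G)=\bigcap_{x_ix_j\in E(G)}(x_i,x_j)$ and its $k$-th symbolic power is $J(G)^{(k)}=\bigcap_{x_ix_j\in E(G)}(x_i,x_j)^k$ for $k\geq 1$ (both equal $S$ if $G$ has no edges); $J(G)^{(0)}=S$, which has regularity $0$. The regularity of a graded $S$-module $M$ is ${\rm reg}(M)=\max\{j-i\mid \beta_{i,j}(M)\neq 0\}$. For a set $A$ of vertices, $N_G(A)=\bigcup_{x\in A}N_G(x)$ and $N_G[A]=N_G(A)\cup A$; $G\setminus B$ denotes the graph obtained by deleting the vertices in $B$. Define $$\gamma_0(G)=\max\Big\{\tfrac{|V(G)|+|N_G(A)|-|A|}{2}\;\Big|\; A \text{ is a (possibly empty) independent set of } G \text{ and any bipartite connected component of } G\setminus N_G[A] \text{ is an isolated vertex}\Big\}.$$ *)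

(* Defs.v *)
From HB Require Import structures.
From mathcomp Require Import all_boot all_order all_algebra.
From mathcomp Require Import mpoly.

Set Implicit Arguments.
Unset Strict Implicit.
Unset Printing Implicit Defensive.

Import Order.TTheory GRing.Theory Num.Theory.
Local Open Scope ring_scope.

(* A simple graph with vertex set 'I_n is an edge relation e : rel 'I_n,
   assumed symmetric and irreflexive. *)

Section Graphs.
Variables (n : nat) (e : rel 'I_n).
Implicit Types A B C : {set 'I_n}.

Definition nbh A : {set 'I_n} := [set y | [exists x in A, e x y]].

Definition closed_nbh A : {set 'I_n} := nbh A :|: A.

Definition independent A : bool :=
  [forall x in A, forall y in A, ~~ e x y].

(* The vertex set of G \ B is ~: B; del_edge B is its edge relation. *)
Definition del_edge B : rel 'I_n :=
  fun x y => [&& e x y, x \notin B & y \notin B].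

Definition del_component B (x : 'I_n) : {set 'I_n} :=
  [set y | connect (del_edge B) x y].

Definition bipartite_on C : bool :=
  [exists X : {set 'I_n}, forall x in C, forall y in C,
     e x y ==> ((x \in X) != (y \in X))].

(* A component is an isolated vertex exactly when it is a singleton. *)
Definition bipartite_components_isolated B : bool :=
  [forall x in ~: B,
     bipartite_on (del_component B x) ==> (del_component B x == [set x])].

Definition gamma0_admissible A : bool :=
  independent A && bipartite_components_isolated (closed_nbh A).

(* The default value 0 of the maximum is harmless: every maximal independent
   set is admissible, and all the terms are nonnegative since #|A| <= n. *)
Definition gamma0 : rat :=
  \big[Num.max/0]_(A : {set 'I_n} | gamma0_admissible A)
     ((n%:R + #|nbh A|%:R - #|A|%:R) / 2%:R).

End Graphs.

Section Ideals.
Variable S : comNzRingType.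
Implicit Types I J : S -> Prop.

Definition ideal2 (a b : S) : S -> Prop :=
  fun p => exists u v : S, p = u * a + v * b.

Definition ideal_mul I J : S -> Prop := fun p =>
  exists s : seq (S * S),
    (forall u, u \in s -> I u.1 /\ J u.2) /\ p = \sum_(u <- s) u.1 * u.2.

Fixpoint ideal_exp I (k : nat) : S -> Prop :=
  if k is k'.+1 then ideal_mul I (ideal_exp I k') else fun=> True.

End Ideals.

(* For k = 0, or if there are no edges, this is the whole ring. *)
Definition cover_symbolic_power (K : fieldType) (n : nat) (e : rel 'I_n)
    (k : nat) : {mpoly K[n]} -> Prop :=
  fun p => forall i j : 'I_n, e i j -> ideal_exp (ideal2 'X_i 'X_j) k p.
Arguments cover_symbolic_power K {n} e k _.

Section Regularity.
Variables (K : fieldType) (n : nat).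
Local Notation S := {mpoly K[n]}.

(* Minimal graded free resolution
     ... -> F_2 -> F_1 -> F_0 -> I -> 0,   F_i = \bigoplus_t S(- mfr_deg i t),
   of a homogeneous ideal I of S. Elements of F_i are row vectors and maps act
   by right multiplication. The shifts are natural numbers because a minimal
   resolution of a submodule of S has no generator in negative degree. By
   Hilbert's syzygy theorem F_i = 0 for i large, so that finite length need
   not be required. *)
Record minimal_free_resolution (I : S -> Prop) := MinimalFreeResolution {
  mfr_rank : nat -> nat;
  mfr_deg : forall i, 'I_(mfr_rank i) -> nat;
  mfr_aug : 'cV[S]_(mfr_rank 0%N);
  mfr_diff : forall i, 'M[S]_(mfr_rank i.+1, mfr_rank i);
  mfr_aug_homog : forall t, mfr_aug t 0 \is (mfr_deg t).-homog;
  mfr_diff_homog : forall i s t,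
    mfr_diff i s t = 0 \/
    (mfr_deg t <= mfr_deg s)%N /\
    mfr_diff i s t \is (mfr_deg s - mfr_deg t)%N.-homog;
  mfr_aug_image : forall p : S,
    I p <-> exists v : 'rV[S]_(mfr_rank 0%N), p = (v *m mfr_aug) 0 0;
  mfr_exact0 : forall v : 'rV[S]_(mfr_rank 0%N),
    v *m mfr_aug = 0 <-> exists w, v = w *m mfr_diff 0%N;
  mfr_exact : forall i (v : 'rV[S]_(mfr_rank i.+1)),
    v *m mfr_diff i = 0 <-> exists w, v = w *m mfr_diff i.+1;
  (* F_(i+1) is mapped into (x_1, ..., x_n) F_i *)
  mfr_minimal : forall i s t, (mfr_diff i s t)@_0%MM = 0
}.

Definition betti (I : S -> Prop) (F : minimal_free_resolution I)
    (i j : nat) : nat :=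
  #|[set t : 'I_(mfr_rank F i) | mfr_deg t == j]|.

(* reg I = r; minimal free resolutions of I being isomorphic, the choice of F
   is immaterial. *)
Definition has_regularity (I : S -> Prop) (r : int) : Prop :=
  exists F : minimal_free_resolution I,
    (exists i j : nat, betti F i j != 0%N /\ r = j%:Z - i%:Z) /\
    (forall i j : nat, betti F i j != 0%N -> j%:Z - i%:Z <= r).

End Regularity.

(* Main.v *)
Require Import Defs.
From HB Require Import structures.
From mathcomp Require Import all_boot all_order all_algebra.
From mathcomp Require Import mpoly.
From mathcomp Require Import zify lra.
Local Open Scope ring_scope.

(** The regularity of a monomial ideal can be read off its multigraded Koszul
    homology. Let [P] describe the monomials of an ideal [I] of [S]. In
    multidegree [b], the Koszul complex of [I] is the chain complex of the family
    [face P b] of all vertex sets [s] such that [x^b] divided by the product of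
    the variables in [s] is a monomial of [I]. The Betti number [beta_(i, j)] of
    [I] vanishes exactly when these families have no homology in degree [i] for
    all [b] with [|b| = j] ([betti_eq0P]); this is the symmetry of Tor, obtained
    here by shifting degrees along a resolution.

    The ideal [J(G)^(k)] is monomial: its monomials [m] are those with
    [m_x + m_y >= k] on every edge. Fix [b] and [i] and let [U] be the set of the
    vertices at which [b] is 1. Removing these vertices one at a time, by the
    exact sequence of the deletion and the link of a vertex, reduces the
    acyclicity of the family [D] of [J(G)^(k)] at [b], in degree [i], to that of
    the families [T_L] of all [s] disjoint from [U] with [L + s] in [D], in degree
    [i - |L|], where [L] runs over the subsets of [U] ([acyclic_split]). Let [Z]
    be the union of [L] and the zero set of [b]; the variables in [Z] have
    exponent 0 in all the monomials that [T_L] speaks of. Hence: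
    - [T_L] is empty if [Z] is not independent, or if [b_y < k] for a neighbour
      [y] of [Z];
    - [T_L] is a cone over [y] if [b_y > k] for a neighbour [y] of [Z], for then
      [y] is not in [U] and all the edges at [y] are satisfied with room to spare;
    - in the remaining case, [b] is [k] on [N(Z)], and [T_L] is the family of
      [J(G)^(k-2)] at the multidegree [c] that is 0 on [Z], [k - 2] on [N(Z)] and
      [b - 1] elsewhere.
    In the last case [|b| - i] exceeds [|c| - (i - |L|)] by exactly
    [n + |N(Z)| - |Z|], so the homology vanishes as soon as [|b| - i] is greater
    than the regularity of [J(G)^(k-2)] plus the maximum of [n + |N(Z)| - |Z|]
    over all independent sets [Z] ([cover_face_acyclic]).

    This maximum is [2 gamma0]. Among the independent sets [A] at which
    [|N(A)| - |A|] is at least its value at [Z], take one of maximal size. It is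
    admissible: if [G - N[A]] had a bipartite component with an edge, the smaller
    side of that component could be added to [A], and the other side would
    join [N(A)] ([admissible_extension]). *)

Set Implicit Arguments.
Unset Strict Implicit.
Unset Printing Implicit Defensive.
Import Order.TTheory GRing.Theory Num.Theory.

(** * The operators of the Koszul complex *)

(** A chain [c] stands for the sum of the [c s (x) e_s], where [e_s] is the
    exterior product of the basis vectors [e_v], [v] in [s], in increasing
    order. *)
Section Koszul.
Variables (n : nat) (R : comNzRingType) (V : lmodType R).
Local Notation chain := {ffun {set 'I_n} -> V}.
Implicit Types (c : chain) (s : {set 'I_n}) (u v : 'I_n).

(** The sign with which [e_v] moves to its place among the factors of [e_s]. *)
Definition ksign v s : R := (-1) ^+ #|[set u in s | (u < v)%N]|.

(** Interior multiplication by the dual vector of [e_v]. *)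
Definition contract v c : chain :=
  [ffun s : {set 'I_n} => if v \in s then 0 else ksign v s *: c (v |: s)].

(** Exterior multiplication by [e_v]. *)
Definition wedge v c : chain :=
  [ffun s : {set 'I_n} => if v \in s then ksign v s *: c (s :\ v) else 0].

Definition koszul (x : 'I_n -> R) c : chain := \sum_v x v *: contract v c.

Lemma ksignU u v s : u \notin s -> ksign v (u |: s) = (-1) ^+ (u < v)%N * ksign v s.
Proof.
move=> us; rewrite /ksign -exprD; congr (_ ^+ _).
have -> : [set w in u |: s | (w < v)%N] =
  (if (u < v)%N then [set u] else set0) :|: [set w in s | (w < v)%N].
  apply/setP=> w; rewrite !inE; case: (eqVneq w u) => [->|wu] /=.
    by case: ifP => _; rewrite !inE ?eqxx ?andbF.
  by case: ifP; rewrite !inE ?(negPf wu).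
rewrite cardsU; case: ifP => _; last by rewrite set0I cards0 subn0.
rewrite cards1 (_ : _ :&: _ = set0) ?cards0 ?subn0 //.
by apply/setP=> w; rewrite !inE; case: eqP => // ->; rewrite (negPf us).
Qed.

Lemma ksignU1 v s : ksign v (v |: s) = ksign v s.
Proof.
have [vs|vs] := boolP (v \in s); last by rewrite ksignU // ltnn mul1r.
by rewrite (setUidPr _) // sub1set.
Qed.

Lemma ksign_sqr v s : ksign v s * ksign v s = 1.
Proof. by rewrite /ksign -expr2 sqrr_sign. Qed.

Lemma ksign_prod u v : u != v ->
  (-1) ^+ (u < v)%N * (-1) ^+ (v < u)%N = -1 :> R.
Proof.
case: (ltngtP u v) => [_ _|_ _|/val_inj->]; last by rewrite eqxx.
  by rewrite expr1 expr0 mulr1.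
by rewrite expr1 expr0 mul1r.
Qed.

Lemma ksign_cross u v s : u != v -> u \notin s -> v \notin s ->
  ksign u (v |: s) * ksign v (u |: s) = - (ksign u s * ksign v s).
Proof.
move=> uv us vs; rewrite !ksignU // mulrACA ksign_prod 1?eq_sym //.
by rewrite mulN1r.
Qed.

Lemma ksign_swap u v s : u != v -> u \notin s -> v \notin s ->
  ksign u (v |: s) * ksign v s = - (ksign v (u |: s) * ksign u s).
Proof.
move=> uv us vs; rewrite -[LHS]mulr1 -(ksign_sqr v (u |: s)) mulrACA.
by rewrite ksign_cross // mulNr -mulrA (mulrA (ksign v s)) ksign_sqr mul1r mulrC.
Qed.

Lemma contract_anti u v c : contract u (contract v c) = - contract v (contract u c).
Proof.
apply/ffunP=> s; rewrite !ffunE !in_setU1; case: (eqVneq u v) => [->|uv] /=.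
  by case: ifP => _; rewrite ?oppr0 // ?eqxx ?scaler0 oppr0.
case: ifP => us; case: ifP => vs.
- by rewrite oppr0.
- by rewrite scaler0 oppr0.
- by rewrite scaler0 oppr0.
rewrite !scalerA setUCA -scaleNr; congr (_ *: _).
by rewrite mulrC [in RHS]mulrC ksign_swap ?us ?vs // eq_sym.
Qed.

(** In characteristic 2 this does not follow from [contract_anti]. *)
Lemma contract_contract v c : contract v (contract v c) = 0.
Proof.
by apply/ffunP=> s; rewrite !ffunE setU11; case: ifP => _ //; rewrite scaler0.
Qed.

Lemma contract_wedge_anti u v c : u != v ->
  contract u (wedge v c) = - wedge v (contract u c).
Proof.
move=> uv; apply/ffunP=> s; rewrite !ffunE !inE (negPf uv) eq_sym (negPf uv) /=.
case: ifP => us; case: ifP => vs; rewrite ?scaler0 ?oppr0 //.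
have vD : v \notin s :\ v by rewrite !inE eqxx.
have uD : u \notin s :\ v by rewrite !inE us andbF.
have -> : (u |: s) :\ v = u |: s :\ v.
  by apply/setP=> w; rewrite !inE; case: (eqVneq w u) => // ->; rewrite uv.
rewrite !scalerA -scaleNr; congr (_ *: _).
have es : s = v |: s :\ v by rewrite setD1K.
have -> : ksign u s = ksign u (v |: s :\ v) by rewrite -es.
have -> : ksign v s = ksign v (s :\ v) by rewrite es ksignU1 -es.
have -> : ksign v (u |: s) = ksign v (u |: s :\ v).
  by rewrite es setUCA ksignU1 -es.
by rewrite ksign_cross // mulrC.
Qed.

Lemma wedge_contract v c : contract v (wedge v c) + wedge v (contract v c) = c.
Proof.
apply/ffunP=> s; rewrite !ffunE !inE eqxx /=; case: ifP => vs.
  by rewrite add0r setD1K // -{1}(setD1K vs) ksignU1 scalerA ksign_sqr scale1r.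
by rewrite addr0 ksignU1 setU1K ?vs // scalerA ksign_sqr scale1r.
Qed.

Fact contract_is_linear v : linear (contract v).
Proof.
move=> a c c'; apply/ffunP=> s; rewrite !ffunE; case: ifP => _.
  by rewrite scaler0 addr0.
by rewrite scalerDr !scalerA mulrC.
Qed.
HB.instance Definition _ v :=
  GRing.isLinear.Build R chain chain _ (contract v) (contract_is_linear v).

Fact wedge_is_linear v : linear (wedge v).
Proof.
move=> a c c'; apply/ffunP=> s; rewrite !ffunE; case: ifP => _.
  by rewrite scalerDr !scalerA mulrC.
by rewrite scaler0 addr0.
Qed.
HB.instance Definition _ v :=
  GRing.isLinear.Build R chain chain _ (wedge v) (wedge_is_linear v).

Fact koszul_is_linear x : linear (koszul x).
Proof.
move=> a c c'; rewrite /koszul scaler_sumr -big_split; apply: eq_bigr => v _ /=.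
by rewrite linearP scalerDr !scalerA mulrC.
Qed.
HB.instance Definition _ x :=
  GRing.isLinear.Build R chain chain _ (koszul x) (koszul_is_linear x).

Lemma koszulE x c s :
  koszul x c s = \sum_(v | v \notin s) (x v * ksign v s) *: c (v |: s).
Proof.
rewrite /koszul sum_ffunE [RHS]big_mkcond; apply: eq_bigr => v _ /=.
by rewrite !ffunE; case: (v \in s); rewrite ?scaler0 ?scalerA.
Qed.

Lemma contract_koszul x v c : contract v (koszul x c) = - koszul x (contract v c).
Proof.
rewrite /koszul linear_sum -sumrN; apply: eq_bigr => u _ /=.
by rewrite linearZ /= contract_anti scalerN.
Qed.

(** The terms of the double sum cancel in pairs, and the diagonal ones vanish. *)
Lemma koszul_koszul x c : koszul x (koszul x c) = 0.
Proof.
pose a u v := (x u * x v) *: contract u (contract v c).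
have a_anti u v : a u v = - a v u.
  by rewrite /a contract_anti scalerN mulrC.
have -> : koszul x (koszul x c) = \sum_(u < n) \sum_(v < n) a u v.
  rewrite {1}/koszul; apply: eq_bigr => u _; rewrite /koszul linear_sum scaler_sumr.
  by apply: eq_bigr => v _ /=; rewrite linearZ /= scalerA.
have -> : \sum_(u < n) \sum_(v < n) a u v =
    \sum_(u < n) \sum_(v < n | (u < v)%N) a u v +
    \sum_(u < n) \sum_(v < n | (v < u)%N) a u v.
  rewrite -big_split; apply: eq_bigr => u _ /=.
  rewrite (bigID (fun v : 'I_n => (u < v)%N)) /=; congr (_ + _).
  rewrite (bigD1 u) ?ltnn //= {1}/a contract_contract scaler0 add0r.
  by apply: eq_bigl => v; rewrite -leqNgt ltn_neqAle andbC.
rewrite [X in _ + X](exchange_big_dep predT) //= -big_split big1 // => u _ /=.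
by rewrite -big_split big1 // => v _ /=; rewrite a_anti addNr.
Qed.

(** Exterior multiplication by [e_v] is a null-homotopy of the multiplication by
    [x_v]. With [x_v = 1] it contracts cones, and hence also the strands of the
    Koszul complex of [S] in the multidegrees other than 0. *)
Lemma koszul_wedge x v c : koszul x (wedge v c) = x v *: c - wedge v (koszul x c).
Proof.
apply/eqP; rewrite eq_sym subr_eq; apply/eqP.
rewrite /koszul (linear_sum (wedge v)) -big_split (bigD1 v) //= linearZ /=.
rewrite -scalerDr wedge_contract big1 ?addr0 // => u uv.
by rewrite linearZ /= -scalerDr contract_wedge_anti // addNr scaler0.
Qed.

End Koszul.

Lemma koszul_map n (R : comNzRingType) (V W : lmodType R) (f : {linear V -> W})
    (x : 'I_n -> R) (c : {ffun {set 'I_n} -> V}) :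
  koszul x [ffun s => f (c s)] = [ffun s => f (koszul x c s)].
Proof.
apply/ffunP=> s; rewrite ffunE !koszulE linear_sum; apply: eq_bigr => v _.
by rewrite linearZ ffunE.
Qed.

(** * Acyclic families of sets *)

Section Acyclic.
Variables (K : fieldType) (n : nat).
Local Notation chain := {ffun {set 'I_n} -> K^o}.
Local Notation bd := (@koszul n K K^o (fun=> 1)).
Implicit Types (c w : chain) (D : pred {set 'I_n}) (s L U : {set 'I_n}).

Definition supported D c := forall s, c s != 0 -> D s.

(** Over a field and with all [x_v] equal to 1, the Koszul differential is the
    boundary map of the augmented chain complex of the full simplex on ['I_n], a
    set with [i] elements having degree [i]. The boundary [w] may have parts of
    any degree: only its part of degree [i + 1] matters, which [card_part]
    extracts. *)
Definition acyclic D i := forall c,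
  supported D c -> (forall s, c s != 0 -> #|s| = i) -> bd c = 0 ->
  exists2 w, supported D w & bd w = c.

Definition card_part i c : chain :=
  [ffun s : {set 'I_n} => if #|s| == i then c s else 0].

Lemma koszul_card_part i c : bd (card_part i.+1 c) = card_part i (bd c).
Proof.
apply/ffunP=> s; rewrite ffunE !koszulE; case: ifP => si; last first.
  apply: big1 => v vs; rewrite ffunE cardsU1 vs add1n eqSS si.
  by rewrite scaler0.
by apply: eq_bigr => v vs; rewrite ffunE cardsU1 vs add1n eqSS si.
Qed.

Lemma eq_acyclic D D' i : D =1 D' -> acyclic D i -> acyclic D' i.
Proof.
move=> eD aD c cD ci c0; have [|w wD wc] := aD c _ ci c0.
  by move=> s /cD; rewrite eD.
by exists w => // s /wD; rewrite eD.
Qed.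

(** Exterior multiplication by the apex [v] contracts the cone. *)
Lemma acyclic_cone D v i : (forall s, D s -> D (v |: s)) -> acyclic D i.
Proof.
move=> coneD c cD _ c0; exists (wedge v c); last first.
  by rewrite koszul_wedge c0 raddf0 subr0 scale1r.
move=> s; rewrite ffunE; case: ifP => [vs|]; last by rewrite eqxx.
rewrite scaler_eq0 negb_or => /andP[_ /cD /coneD].
by rewrite setD1K.
Qed.

(** Exactness of the homology sequence of the deletion and the link of [v]: a
    cycle [c] is first corrected by a boundary, so that it avoids [v]. *)
Lemma acyclic_vertex_split D v i :
  (forall s, D (v |: s) -> D s) ->
  acyclic (fun s => (v \notin s) && D s) i ->
  (forall j, i = j.+1 -> acyclic (fun s => (v \notin s) && D (v |: s)) j) ->
  acyclic D i.
Proof.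
move=> downD del link c cD ci c0; case: i ci del link => [|j] ci del link.
  have [|w wD wc] := del c _ ci c0; last by exists w => // s /wD/andP[].
  move=> s cs; rewrite cD // andbT; move/eqP: (ci s cs).
  by rewrite cards_eq0 => /eqP->; rewrite inE.
(* The part of [c] at [v] is a cycle of the link, hence bounds there. *)
have [|s||w wD wc] := link j erefl (contract v c).
- move=> s; rewrite ffunE; case: ifP => vs; first by rewrite eqxx.
  by rewrite scaler_eq0 negb_or => /andP[_ /cD].
- rewrite ffunE; case: ifP => vs; first by rewrite eqxx.
  rewrite scaler_eq0 negb_or => /andP[_ /ci].
  by rewrite cardsU1 vs add1n => -[].
- by rewrite -[LHS]opprK -contract_koszul c0 raddf0 oppr0.
pose w' := card_part j.+1 w.
have w'c : bd w' = contract v c.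
  rewrite koszul_card_part wc; apply/ffunP=> s; rewrite ffunE; case: ifP => //.
  move=> sj; rewrite ffunE; case: ifP => // vs; apply/eqP; rewrite eq_sym.
  rewrite scaler_eq0; case: eqP => /= [//|_]; apply: contraFT sj => /ci.
  by rewrite cardsU1 vs add1n => -[->].
have w's s : w' s != 0 -> [/\ v \notin s, D (v |: s) & #|s| = j.+1].
  rewrite ffunE; case: ifP => [/eqP sj /wD/andP[]//|]; by rewrite eqxx.
clearbody w'.
(* The second term is the part of [c] that avoids [v]; the sum differs from [c]
   by a boundary. *)
pose c' := w' + contract v (wedge v c).
have ec' : c' = c + bd (wedge v w').
  rewrite koszul_wedge w'c scale1r addrCA /c'; congr (_ + _).
  by rewrite -[X in _ = X - _](wedge_contract v c) addrK.
have c's s : c' s != 0 -> w' s != 0 \/ (v \notin s) && (c s != 0).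
  rewrite !ffunE; case: (eqVneq (w' s) 0) => [->|]; last by left.
  rewrite add0r; case: ifP => vs; first by rewrite eqxx.
  rewrite setU11 scalerA setU1K ?vs // ksignU1 ksign_sqr scale1r.
  by right.
have [s|s||w2 w2D w2c] := del c'.
- case/c's => [/w's[-> /downD]//|/andP[-> /cD]//].
- by case/c's => [/w's[]//|/andP[_ /ci]//].
- by rewrite ec' raddfD /= c0 koszul_koszul addr0.
exists (w2 - wedge v w'); last by rewrite raddfB /= w2c ec' addrK.
move=> s; rewrite !ffunE; case: (eqVneq (w2 s) 0) => [->|/w2D/andP[]//].
rewrite sub0r oppr_eq0; case: ifP => vs; last by rewrite eqxx.
by rewrite scaler_eq0 negb_or => /andP[_ /w's[_]]; rewrite setD1K.
Qed.

(** Iterating [acyclic_vertex_split] over the vertices of [U]; [L] collects those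
    at which the link was taken, each of which lowers the degree by 1. *)
Lemma acyclic_split U D i :
  (forall v s, D (v |: s) -> D s) ->
  (forall L j, L \subset U -> i = (#|L| + j)%N ->
     acyclic (fun s => [disjoint s & U] && D (L :|: s)) j) ->
  acyclic D i.
Proof.
have [m] := ubnP #|U|; elim: m => // m IHm in U D i *; rewrite ltnS.
move=> Um downD acycD.
have [U0|[v vU]] := set_0Vmem U.
  apply: eq_acyclic (acycD set0 i (sub0set _) _); last by rewrite cards0.
  by move=> s; rewrite -setI_eq0 U0 setI0 eqxx set0U.
have U'm : (#|U :\ v| < m)%N.
  by move: Um; rewrite (cardsD1 v) vU.
have disjU s : [disjoint s & U] = (v \notin s) && [disjoint s & U :\ v].
  by rewrite -{1}(setD1K vU) !disjoints_subset setCU subsetI subsetC sub1set inE.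
apply: (@acyclic_vertex_split _ v) => [s||j ij].
- exact: downD.
- apply: (IHm (U :\ v)) => // [u s /andP[]|L j LU' ij].
    by rewrite !inE negb_or => /andP[_ ->] /downD.
  have vL : v \notin L by apply/negP=> /(subsetP LU'); rewrite !inE eqxx.
  apply: eq_acyclic (acycD L j (subset_trans LU' (subD1set _ _)) ij) => s.
  by rewrite disjU !inE negb_or vL andbCA andbA.
apply: (IHm (U :\ v)) => // [u s /andP[]|L j' LU' jj'].
  by rewrite !inE negb_or => /andP[_ ->]; rewrite setUCA => /downD.
have vL : v \notin L by apply/negP=> /(subsetP LU'); rewrite !inE eqxx.
have LU : v |: L \subset U.
  by rewrite subUset sub1set vU (subset_trans LU' (subD1set _ _)).
apply: eq_acyclic (acycD (v |: L) j' LU _) => [s|].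
  by rewrite disjU !inE negb_or vL setUA andbCA andbA.
by rewrite cardsU1 vL ij jj'.
Qed.

End Acyclic.

(** * Koszul chains of polynomials and their multigraded parts *)

Lemma koszul_regularE n (R : comNzRingType) (x : 'I_n -> R)
    (c : {ffun {set 'I_n} -> R^o}) s :
  koszul x c s = \sum_(v | v \notin s) x v * ksign R v s * c (v |: s) :> R.
Proof. by rewrite koszulE. Qed.

Section Monomial.
Variables (K : fieldType) (n : nat).
Local Notation S := {mpoly K[n]}.
Local Notation X := (fun v : 'I_n => 'X_v : S).
Local Notation bd := (@koszul n K K^o (fun=> 1)).
Implicit Types (P : pred 'X_{1..n}) (b m : 'X_{1..n}) (p q : S) (s : {set 'I_n}).
Implicit Types (z : {ffun {set 'I_n} -> S^o}) (c : {ffun {set 'I_n} -> K^o}).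

Definition monomial_ideal P p := forall m, p@_m != 0 -> P m.

(** The upper Koszul complex, at [b], of the ideal with the monomials [P]. *)
Definition face P b s := (mesym1 s <= b)%MM && P (b - mesym1 s)%MM.

(** The basis element [e_s] has the multidegree of the squarefree monomial
    [mesym1 s], whence the exponent [b - mesym1 s]. *)
Definition multipart b z : {ffun {set 'I_n} -> K^o} :=
  [ffun s : {set 'I_n} =>
     if (mesym1 s <= b)%MM then (z s : S)@_(b - mesym1 s) else 0].

Definition monomial_chain b c : {ffun {set 'I_n} -> S^o} :=
  [ffun s : {set 'I_n} =>
     if (mesym1 s <= b)%MM then (c s : K) *: 'X_[b - mesym1 s] : S else 0].

Lemma mesym1U v s : v \notin s -> mesym1 (v |: s) = (U_(v) + mesym1 s)%MM.
Proof.
move=> vs; apply/mnmP=> i; rewrite !mnmE !inE eq_sym.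
by case: (eqVneq v i) => [<-|]; rewrite ?(negPf vs).
Qed.

Lemma mesym1U_le v s b : v \notin s ->
  (mesym1 (v |: s) <= b)%MM = (mesym1 s <= b)%MM && (U_(v) <= b - mesym1 s)%MM.
Proof.
move=> vs; rewrite mesym1U //; apply/mnm_lepP/andP.
  move=> h; split; apply/mnm_lepP=> i; have := h i; rewrite mnmDE ?mnmBE; lia.
by move=> [/mnm_lepP h1 /mnm_lepP h2] i; have := h1 i; have := h2 i;
  rewrite mnmDE mnmBE; lia.
Qed.

Lemma ksign_mpolyC v s : ksign S v s = (ksign K v s)%:MP.
Proof. by rewrite /ksign rmorphXn rmorphN1. Qed.

Lemma mcoeffXM v q m :
  ('X_v * q)@_m = if (U_(v) <= m)%MM then q@_(m - U_(v)) else 0.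
Proof.
rewrite mulrC; case: ifP => [vm|/negbT vm].
  by have := mcoeffMX q U_(v) (m - U_(v)); rewrite addmC submK.
apply: memN_msupp_eq0; apply: contra vm; rewrite (perm_mem (msuppMX q _)).
by case/mapP=> m' _ ->; apply: lem_addr.
Qed.

Lemma multipart_koszul b z : multipart b (koszul X z) = bd (multipart b z).
Proof.
apply/ffunP=> s; rewrite ffunE koszul_regularE; case: ifP => sb.
  rewrite koszul_regularE raddf_sum; apply: eq_bigr => v vs /=.
  rewrite ffunE mesym1U_le // sb /= -mulrA mcoeffXM ksign_mpolyC mcoeffCM mul1r.
  by case: ifP => _; rewrite ?mulr0 // mesym1U // addmC submDA.
rewrite koszul_regularE big1 // => v vs; rewrite ffunE mesym1U_le // sb /=.
by rewrite mulr0.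
Qed.

Lemma koszul_monomial_chain b c :
  supported (fun s => (mesym1 s <= b)%MM) c ->
  koszul X (monomial_chain b c) = monomial_chain b (bd c).
Proof.
move=> cb; apply/ffunP=> s; rewrite ffunE !koszul_regularE; case: ifP => sb.
  rewrite scaler_suml; apply: eq_bigr => v vs.
  rewrite ffunE ksign_mpolyC mul1r; case: ifP => vsb; last first.
    suff -> : c (v |: s) = 0 by rewrite !mulr0 scale0r.
    by apply: contraFeq vsb => /cb.
  rewrite -mulrA mul_mpolyC -!scalerAr scalerA -mpolyXD; congr (_ *: 'X_[_]).
  move: vsb; rewrite mesym1U_le // mesym1U // => /andP[_ vb].
  by rewrite [(U_(v) + mesym1 s)%MM]addmC -submDA addmC submK.
rewrite big1 // => v vs; rewrite ffunE mesym1U_le // sb /=.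
by rewrite mulr0.
Qed.

Lemma multipart_monomial_chain b c :
  supported (fun s => (mesym1 s <= b)%MM) c -> multipart b (monomial_chain b c) = c.
Proof.
move=> cb; apply/ffunP=> s; rewrite !ffunE; case: ifP => sb.
  by rewrite ?sb mcoeffZ mcoeffX eqxx mulr1.
by apply/esym; apply: contraFeq sb => /cb.
Qed.

(** [N] bounds the multidegrees that occur in [z], as [e_s] adds at most [n]. *)
Lemma monomial_chain_sum N z : (forall s, (msize (z s : S) + n <= N)%N) ->
  \sum_(b : 'X_{1..n < N}) monomial_chain b (multipart b z) = z.
Proof.
move=> zN; apply/ffunP=> s; apply/mpolyP=> m; rewrite sum_ffunE raddf_sum /=.
have F (d : 'X_{1..n < N}) : (monomial_chain d (multipart d z) s : S)@_m =
    if (d : 'X_{1..n}) == (m + mesym1 s)%MM then (z s : S)@_m else 0.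
  rewrite !ffunE; case: eqP => [->|ne].
    by rewrite lem_addl addmK mcoeffZ mcoeffX eqxx mulr1.
  case: ifP => sb; last exact: mcoeff0.
  rewrite mcoeffZ mcoeffX; case: eqP => [e|]; last by rewrite mulr0.
  by case: ne; rewrite -e submK.
rewrite (eq_bigr _ (fun d _ => F d)).
case: (ltnP (mdeg (m + mesym1 s)%MM) N) => [mN|Nm].
  rewrite (bigD1 (BMultinom mN)) //= eqxx big1 ?addr0 // => b.
  by rewrite -val_eqE /= => /negPf->.
rewrite big1 => [|b _].
  rewrite mdegD mdeg_mesym1 in Nm.
  apply/esym/memN_msupp_eq0/msize_mdeg_ge; rewrite -(leq_add2r #|s|).
  apply: leq_trans Nm; apply: leq_trans (zN s).
  by rewrite leq_add2l -[leqRHS]card_ord max_card.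
by case: eqP => // e; have := bmdeg b; rewrite e ltnNge Nm.
Qed.

(** Multigraded boundaries of the finitely many parts of [z] add up to one of
    [z]. *)
Lemma koszul_boundary_monomial P z :
  (forall b, exists2 w, supported (face P b) w & bd w = multipart b z) ->
  exists2 w : {ffun {set 'I_n} -> S^o},
    (forall s, monomial_ideal P (w s)) & koszul X w = z.
Proof.
move=> zb; pose N := (\max_s msize (z s : S) + n)%N.
have zN s : (msize (z s : S) + n <= N)%N by rewrite leq_add2r (leq_bigmax s).
have /fin_all_exists[w wP] (d : 'X_{1..n < N}) :
    exists w, supported (face P d) w /\ bd w = multipart d z.
  by have [w ? ?] := zb d; exists w.
exists (\sum_(d : 'X_{1..n < N}) monomial_chain d (w d)); last first.
  rewrite linear_sum -[RHS](monomial_chain_sum zN); apply: eq_bigr => b _ /=.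
  by have [wb <-] := wP b; rewrite koszul_monomial_chain // => s /wb/andP[].
move=> s m; apply: contraR => Pm; rewrite sum_ffunE raddf_sum big1 //= => b _.
rewrite ffunE; case: ifP => sb; last exact: mcoeff0.
rewrite mcoeffZ mcoeffX; case: eqP => [em|]; last by rewrite mulr0.
rewrite mulr1; apply: contraNeq Pm => /(wP b).1/andP[_].
by rewrite em.
Qed.

(** Exactness of the Koszul complex of [S], except for its homology [K] in degree
    0: the part in multidegree [b] is contracted by any vertex in the support of
    [b], and the part in multidegree 0 is the constant term at the empty set. *)
Lemma koszul_exact z : koszul X z = 0 -> (z set0 : S)@_0%MM = 0 ->
  exists w : {ffun {set 'I_n} -> S^o}, koszul X w = z.
Proof.
move=> z0 z00.
have [|w _ <-] := @koszul_boundary_monomial predT z; last by exists w.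
move=> b; have c0 : bd (multipart b z) = 0.
  by rewrite -multipart_koszul z0; apply/ffunP=> s; rewrite !ffunE mcoeff0 if_same.
have [b0|] := eqVneq b 0%MM.
  exists 0; first by move=> s; rewrite ffunE eqxx.
  rewrite raddf0; apply/ffunP=> s; rewrite !ffunE b0; case: ifP => // s0.
  suff -> : s = set0 by rewrite mesym1_set0 subm0 z00.
  apply/setP=> i; rewrite inE; move/mnm_lepP/(_ i): s0; rewrite !mnmE.
  by case: (i \in s).
rewrite -mdeg_eq0 mdegE sum_nat_eq0 negb_forall => /existsP[v /= bv].
exists (wedge v (multipart b z)); last by rewrite koszul_wedge c0 raddf0 subr0 scale1r.
move=> s; rewrite ffunE /face andbT; case: ifP => vs; last by rewrite eqxx.
rewrite scaler_eq0 negb_or ffunE => /andP[_].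
case: ifP => [sb _|]; last by rewrite eqxx.
apply/mnm_lepP=> i; move/mnm_lepP/(_ i): sb; rewrite !mnmE !inE.
by case: (eqVneq i v) => [->|//]; case: (v \in s) => // _; rewrite lt0n.
Qed.

End Monomial.

(** * The grading of Koszul chains over free modules *)

Lemma koszul_rowE n (R : comNzRingType) m (x : 'I_n -> R)
    (z : {ffun {set 'I_n} -> 'rV[R]_m}) s t :
  koszul x z s 0 t = \sum_(v | v \notin s) x v * ksign R v s * z (v |: s) 0 t.
Proof. by rewrite koszulE summxE; apply: eq_bigr => v _; rewrite mxE. Qed.

Section Graded.
Variables (K : fieldType) (n : nat).
Local Notation S := {mpoly K[n]}.
Local Notation X := (fun v : 'I_n => 'X_v : S).
Local Notation chain m := {ffun {set 'I_n} -> 'rV[S]_m}.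

(** The degree [j] part of [p] as an element of [S(-d)]. *)
Definition degpart (j d : nat) (p : S) : S :=
  if (d <= j)%N then pihomog mdeg (j - d) p else 0.

Fact degpart_is_linear j d : linear (degpart j d).
Proof.
move=> a p q; rewrite /degpart; case: ifP => _; first exact: linearP.
by rewrite scaler0 addr0.
Qed.
HB.instance Definition _ j d :=
  GRing.isLinear.Build K S S _ (degpart j d) (degpart_is_linear j d).

Lemma degpart_homog j d e p : p \is e.-homog ->
  degpart j d p = if (e + d == j)%N then p else 0.
Proof.
move=> pe; rewrite /degpart; case: leqP => [dj|jd]; last by case: eqP => // h; lia.
case: eqP => [<-|ne]; first by rewrite addnK pihomog_dE.
by apply: pihomog_ne0 pe; apply/eqP; lia.
Qed.

Lemma degpart_mul j d e p q : q \is e.-homog ->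
  degpart j d (p * q) = degpart j (d + e) p * q.
Proof.
move=> qe; rewrite [p]mpolyE mulr_suml !linear_sum mulr_suml; apply: eq_bigr => m _ /=.
rewrite -scalerAl !linearZ /= -scalerAl; congr (_ *: _).
rewrite (@degpart_homog _ _ (mdeg m + e)); last first.
  by apply: dhomogM => //; rewrite dhomogX.
rewrite (@degpart_homog _ _ (mdeg m)) ?dhomogX // -addnA [(e + d)%N]addnC.
by case: ifP => _; rewrite ?mul0r.
Qed.

Lemma mcoeff_degpart j d p m :
  (degpart j d p)@_m = if (mdeg m + d == j)%N then p@_m else 0.
Proof.
transitivity (\sum_(k <- msupp p)
    if (mdeg m + d == j)%N then (p@_k *: 'X_[k] : S)@_m else 0).
  rewrite {1}[p]mpolyE linear_sum raddf_sum; apply: eq_bigr => k _ /=.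
  rewrite linearZ /= (@degpart_homog _ _ (mdeg k)) ?dhomogX //= !mcoeffZ mcoeffX.
  have [->|km] := eqVneq k m.
    by case: ifP; rewrite ?mcoeffX ?eqxx ?mcoeff0 ?mulr0.
  rewrite mulr0 if_same; case: ifP; rewrite ?mcoeff0 ?mulr0 // mcoeffX.
  by rewrite (negPf km) mulr0.
case: ifP => _; last by rewrite big1.
by rewrite [in RHS](mpolyE p) raddf_sum.
Qed.

(** The part of homological degree [i] and internal degree [j] of a chain over the
    graded free module with generators in the degrees [D]. *)
Definition gradepart j i m (D : 'I_m -> nat) (z : chain m) : chain m :=
  [ffun s : {set 'I_n} =>
     if #|s| == i then \row_t degpart j (D t + i) (z s 0 t) else 0].

Lemma koszul_gradepart j i m (D : 'I_m -> nat) (z : chain m) :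
  koszul X (gradepart j i.+1 D z) = gradepart j i D (koszul X z).
Proof.
apply/ffunP=> s; apply/rowP=> t; rewrite [LHS]koszul_rowE [in RHS]ffunE.
case: ifP => si; last first.
  rewrite [RHS]mxE big1 // => v vs; rewrite ffunE cardsU1 vs add1n eqSS si mxE.
  by rewrite mulr0.
rewrite [RHS]mxE koszul_rowE linear_sum; apply: eq_bigr => v vs /=.
rewrite ffunE cardsU1 vs add1n eqSS si mxE mulrC addnS -addn1 -degpart_mul.
  by rewrite mulrC.
rewrite ksign_mpolyC mulrC mul_mpolyC; apply: dhomogZ.
by rewrite dhomogX /= mdeg1.
Qed.

Definition mulchain m m' (A : 'M[S]_(m, m')) (z : chain m) : chain m' :=
  [ffun s => z s *m A].

Lemma koszul_mulchain m m' (A : 'M[S]_(m, m')) (z : chain m) :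
  koszul X (mulchain A z) = mulchain A (koszul X z).
Proof. exact: (koszul_map (mulmxr A)). Qed.

Lemma gradepart_mulchain j i m m' (D : 'I_m -> nat) (D' : 'I_m' -> nat)
    (A : 'M[S]_(m, m')) (z : chain m) :
  (forall s t, A s t = 0 \/ (D' t <= D s)%N /\ A s t \is (D s - D' t)%N.-homog) ->
  gradepart j i D' (mulchain A z) = mulchain A (gradepart j i D z).
Proof.
move=> homA; apply/ffunP=> s; rewrite !ffunE; case: ifP => _; last by rewrite mul0mx.
apply/rowP=> t; rewrite !mxE linear_sum; apply: eq_bigr => u _ /=.
rewrite mxE; case: (homA u t) => [->|[le homAut]].
  by rewrite !mulr0 linear0.
by rewrite (degpart_mul _ _ _ homAut); congr (degpart _ _ _ * _); lia.
Qed.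

Lemma koszul_exact_row m (z : chain m) :
  koszul X z = 0 -> (forall t, (z set0 0 t)@_0%MM = 0) ->
  exists w : chain m, koszul X w = z.
Proof.
move=> z0 z00.
have /fin_all_exists[w wz] t : exists w : {ffun {set 'I_n} -> S^o},
    koszul X w = [ffun s => z s 0 t].
  apply: koszul_exact; last by rewrite ffunE.
  apply/ffunP=> s; rewrite koszul_regularE ffunE.
  transitivity (koszul X z s 0 t); last by rewrite z0 ffunE mxE.
  by rewrite koszul_rowE; apply: eq_bigr => v _; rewrite ffunE.
exists [ffun s => \row_t w t s]; apply/ffunP=> s; apply/rowP=> t.
have /ffunP/(_ s) := wz t; rewrite ffunE koszul_rowE => <-.
by rewrite koszul_regularE; apply: eq_bigr => v _; rewrite ffunE mxE.
Qed.

Lemma koszul_coef0 m (z : chain m) t : (koszul X z set0 0 t)@_0%MM = 0.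
Proof.
rewrite koszul_rowE raddf_sum big1 // => v _ /=.
rewrite -mulrA mcoeffXM; case: ifP => // /mnm_lepP/(_ v).
by rewrite mnm1E eqxx mnm0E.
Qed.

Lemma koszul_gradepart0 j m (D : 'I_m -> nat) (z : chain m) :
  koszul X (gradepart j 0 D z) = 0.
Proof.
apply/ffunP=> s; rewrite koszulE ffunE big1 // => v vs.
by rewrite ffunE cardsU1 vs scaler0.
Qed.

End Graded.

(** * Shifting degrees along a resolution *)

(** The resolution is augmented: the ideal that it resolves is the image of [A 0]
    in a free module of rank 1, and the image of [A q] is the [q]-th syzygy
    module, identified by [A_exact] with the kernel of the preceding map. *)
Section Resolution.
Variables (K : fieldType) (n : nat).
Local Notation S := {mpoly K[n]}.
Local Notation X := (fun v : 'I_n => 'X_v : S).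
Local Notation chain m := {ffun {set 'I_n} -> 'rV[S]_m}.

Lemma gradepart_id j i m (D : 'I_m -> nat) (z : chain m) :
  gradepart j i D (gradepart j i D z) = gradepart j i D z.
Proof.
apply/ffunP=> s; rewrite !ffunE; case: ifP => // si; apply/rowP=> t.
rewrite !mxE; apply/mpolyP=> k.
by rewrite !mcoeff_degpart si mxE mcoeff_degpart; case: eqP.
Qed.

Lemma mulchainB m m' (A : 'M[S]_(m, m')) (y z : chain m) :
  mulchain A (y - z) = mulchain A y - mulchain A z.
Proof. by apply/ffunP=> s; rewrite !ffunE mulmxBl. Qed.

Lemma mulchain0 m m' (A : 'M[S]_(m, m')) : mulchain A 0 = 0.
Proof. by apply/ffunP=> s; rewrite !ffunE mul0mx. Qed.

Variables (rk : nat -> nat) (dg : forall q, 'I_(rk q) -> nat).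
Variable (A : forall q, 'M[S]_(rk q.+1, rk q)).
Hypothesis A_exact : forall q (v : 'rV[S]_(rk q.+1)),
  v *m A q = 0 <-> exists w, v = w *m A q.+1.
Hypothesis A_homog : forall q s t, A q s t = 0 \/
  (dg t <= dg s)%N /\ A q s t \is (dg s - dg t)%N.-homog.

Lemma mulchain_gradepart j p q (y : chain (rk q.+1)) :
  mulchain (A q) (gradepart j p (@dg q.+1) y) =
  gradepart j p (@dg q) (mulchain (A q) y).
Proof. by rewrite (gradepart_mulchain _ _ _ (@A_homog q)). Qed.

(** The [q]-th syzygy module has no Koszul homology in homological degree [p] and
    internal degree [j]. *)
Definition koszul_vanishes j p q := forall y : chain (rk q.+1),
  koszul X (mulchain (A q) y) = 0 ->
  gradepart j p (@dg q) (mulchain (A q) y) = mulchain (A q) y ->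
  exists w, koszul X (mulchain (A q) w) = mulchain (A q) y.

Lemma mulchain_lift q (y : chain (rk q.+1)) :
  mulchain (A q) y = 0 -> exists w, y = mulchain (A q.+1) w.
Proof.
move=> yA; have /fin_all_exists[w yw] s : exists w, y s = w *m A q.+1.
  by apply/A_exact; move/ffunP/(_ s): yA; rewrite !ffunE.
by exists (finfun w); apply/ffunP=> s; rewrite !ffunE.
Qed.

Lemma mulchain_comp q (y : chain (rk q.+2)) :
  mulchain (A q) (mulchain (A q.+1) y) = 0.
Proof.
by apply/ffunP=> s; rewrite !ffunE; apply/A_exact; exists (y s).
Qed.

(** Lifted to the free module, a cycle [y] has its differential in the next syzygy
    module, where it is a cycle of degree one less. If it bounds there, [y] can be
    corrected to a cycle of the free module, whose Koszul complex is exact. At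
    [p = 0], without generators of degree [j] the lift has no constant term. *)
Lemma koszul_vanishes_of_degrees j p q :
  (forall r, r = (p + q)%N -> forall t : 'I_(rk r.+1), dg t != j) ->
  koszul_vanishes j p q.
Proof.
elim: p q => [|p IHp] q dgj y yA0 gry.
  pose y0 := gradepart j 0 (@dg q.+1) y.
  have [|t|g gy] := @koszul_exact_row _ _ _ y0; first exact: koszul_gradepart0.
    rewrite ffunE cards0 eqxx mxE mcoeff_degpart mdeg0 addn0 add0n.
    by rewrite (negPf (dgj q erefl t)).
  by exists g; rewrite koszul_mulchain gy -[RHS]gry -mulchain_gradepart.
pose y1 := gradepart j p.+1 (@dg q.+1) y.
have y1A : mulchain (A q) y1 = mulchain (A q) y by rewrite mulchain_gradepart.
have [u yu] : exists u, koszul X y1 = mulchain (A q.+1) u.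
  by apply: mulchain_lift; rewrite -koszul_mulchain y1A.
have [r rpq t|||v0 v0u] := IHp q.+1 _ u.
- by apply: dgj; rewrite rpq addnS addSn.
- by rewrite -yu koszul_koszul.
- by rewrite -yu koszul_gradepart gradepart_id.
pose v := gradepart j p.+1 (@dg q.+2) v0.
have vu : koszul X (mulchain (A q.+1) v) = koszul X y1.
  rewrite mulchain_gradepart koszul_gradepart v0u yu -yu.
  by rewrite koszul_gradepart gradepart_id.
have [|t|w wy] := @koszul_exact_row _ _ _ (y1 - mulchain (A q.+1) v).
- by rewrite raddfB /= vu subrr.
- rewrite mulchain_gradepart !ffunE cards0 /= !mxE subrr.
  exact: mcoeff0.
by exists w; rewrite koszul_mulchain wy mulchainB mulchain_comp subr0.
Qed.

Hypothesis A_minimal : forall q s t, (A q.+1 s t)@_0%MM = 0.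

Lemma mulchain_coef0 q (y : chain (rk q.+2)) s t :
  (mulchain (A q.+1) y s 0 t)@_0%MM = 0.
Proof.
rewrite ffunE mxE raddf_sum big1 //= => u _.
by rewrite rmorphM /= A_minimal mulr0.
Qed.

(** The converse shift. A cycle of the [q.+1]-st syzygy module bounds some [y] in
    the free module, by minimality also if [p = 0]; the image of [y] in the [q]-th
    syzygy module is a cycle, and a boundary of it corrects [y]. *)
Lemma koszul_vanishes_shift j p q :
  koszul_vanishes j p.+1 q -> koszul_vanishes j p q.+1.
Proof.
move=> van x xA0 grx.
have [//|t|y0 y0x] := @koszul_exact_row _ _ _ (mulchain (A q.+1) x).
  exact: mulchain_coef0.
pose y := gradepart j p.+1 (@dg q.+1) y0.
have yx : koszul X y = mulchain (A q.+1) x by rewrite koszul_gradepart y0x.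
have [||w wy] := van y.
- by rewrite koszul_mulchain yx mulchain_comp.
- by rewrite -mulchain_gradepart gradepart_id.
have [v yv] : exists v, y - koszul X w = mulchain (A q.+1) v.
  by apply: mulchain_lift; rewrite mulchainB -koszul_mulchain wy subrr.
by exists v; rewrite -yv raddfB /= koszul_koszul subr0.
Qed.

(** A generator of degree [j] would be, up to a relation, a combination of
    generators without constant coefficients; by minimality, relations have no
    constant coefficients either. *)
Lemma koszul_vanishes0_degrees j q :
  koszul_vanishes j 0 q -> forall t : 'I_(rk q.+1), dg t != j.
Proof.
move=> van t; apply/negP=> /eqP dgt.
pose y : chain (rk q.+1) := [ffun s => if s == set0 then delta_mx 0 t else 0].
have gry : gradepart j 0 (@dg q.+1) y = y.
  apply/ffunP=> s; rewrite !ffunE cards_eq0; case: ifP => // s0; apply/rowP=> u.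
  rewrite s0 !mxE eqxx /= (@degpart_homog _ _ _ _ 0); last first.
    by case: eqP => _; rewrite ?mulr1n ?mulr0n; [apply: dhomog1|apply: dhomog0].
  by rewrite addn0 add0n; case: (eqVneq u t) => [->|]; rewrite ?dgt ?eqxx ?if_same.
have [||w wy] := van y.
- by rewrite koszul_mulchain -gry koszul_gradepart0 mulchain0.
- by rewrite -mulchain_gradepart gry.
have [v yv] : exists v, y - koszul X w = mulchain (A q.+1) v.
  by apply: mulchain_lift; rewrite mulchainB -koszul_mulchain wy subrr.
have := mulchain_coef0 v set0 t; rewrite -yv !ffunE eqxx !mxE mcoeffB koszul_coef0.
by rewrite !eqxx subr0 mcoeff1 eqxx => /eqP; rewrite oner_eq0.
Qed.

Lemma degrees_of_koszul_vanishes j p q :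
  koszul_vanishes j p q -> forall r, r = (p + q)%N ->
  forall t : 'I_(rk r.+1), dg t != j.
Proof.
elim: p q => [|p IHp] q van r ->; first exact: koszul_vanishes0_degrees.
by apply: (IHp q.+1); [apply: koszul_vanishes_shift|rewrite addnS addSn].
Qed.

End Resolution.

(** * Betti numbers of monomial ideals *)

Section MonomialResolution.
Variables (K : fieldType) (n : nat).
Local Notation S := {mpoly K[n]}.
Local Notation X := (fun v : 'I_n => 'X_v : S).
Local Notation chain m := {ffun {set 'I_n} -> 'rV[S]_m}.
Local Notation bd := (@koszul n K K^o (fun=> 1)).
Variable P : pred 'X_{1..n}.

Definition entry (z : chain 1) : {ffun {set 'I_n} -> S^o} := [ffun s => z s 0 0].

Lemma koszul_entry z : koszul X (entry z) = entry (koszul X z).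
Proof.
apply/ffunP=> s; rewrite koszul_regularE ffunE koszul_rowE.
by apply: eq_bigr => v _; rewrite ffunE.
Qed.

Lemma entry_inj : injective entry.
Proof.
move=> z z' /ffunP ezz'; apply/ffunP=> s; apply/rowP=> t; rewrite ord1.
by have := ezz' s; rewrite !ffunE.
Qed.

Lemma mdeg_sub_mesym1 (b : 'X_{1..n}) s : (mesym1 s <= b)%MM ->
  (mdeg (b - mesym1 s)%MM + #|s| = mdeg b)%N.
Proof. by move=> sb; rewrite -[in RHS](submK sb) mdegD mdeg_mesym1. Qed.

Lemma supported_multipart b (z : {ffun {set 'I_n} -> S^o}) :
  (forall s, monomial_ideal P (z s)) -> supported (face P b) (multipart b z).
Proof.
move=> zP s; rewrite ffunE /face; case: ifP => [_ /zP //|]; by rewrite eqxx.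
Qed.

Lemma monomial_ideal_chain b (c : {ffun {set 'I_n} -> K^o}) : supported (face P b) c ->
  forall s, monomial_ideal P (monomial_chain b c s).
Proof.
move=> cP s m; rewrite ffunE; case: ifP => sb; last by rewrite mcoeff0 eqxx.
rewrite mcoeffZ mcoeffX mulf_eq0 negb_or => /andP[/cP/andP[_ Pb]].
by case: (_ =P m) => [<-|_]; rewrite ?eqxx.
Qed.

Variables (m : nat) (A : 'M[S]_(m, 1)).
Hypothesis imA : forall p : S,
  monomial_ideal P p <-> exists v : 'rV[S]_m, p = (v *m A) 0 0.

Lemma entry_mulchain_ideal (y : chain m) s : monomial_ideal P (entry (mulchain A y) s).
Proof. by apply/imA; exists (y s); rewrite !ffunE. Qed.

Lemma entry_mulchain_lift (z : {ffun {set 'I_n} -> S^o}) :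
  (forall s, monomial_ideal P (z s)) -> exists y : chain m, z = entry (mulchain A y).
Proof.
move=> zP; have /fin_all_exists[y yz] s : exists v : 'rV[S]_m, z s = (v *m A) 0 0.
  by apply/imA.
by exists (finfun y); apply/ffunP=> s; rewrite !ffunE.
Qed.

(** Koszul cycles of a monomial ideal bound if and only if their multigraded parts
    do, and these are the chains of the families [face P b]. *)
Lemma koszul_vanishes_monomial j i :
  (forall y : chain m, koszul X (mulchain A y) = 0 ->
     gradepart j i (fun=> 0%N) (mulchain A y) = mulchain A y ->
     exists w, koszul X (mulchain A w) = mulchain A y) <->
  (forall b, mdeg b = j -> acyclic K (face P b) i).
Proof.
split=> [van b bj c cP ci c0 | acyc y y0 gry].
  have cb : supported (fun s => (mesym1 s <= b)%MM) c by move=> s /cP/andP[].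
  have [y yc] := entry_mulchain_lift (monomial_ideal_chain cP).
  have [||w wy] := van y.
  - apply: entry_inj; rewrite -koszul_entry -yc koszul_monomial_chain // c0.
    by apply/ffunP=> s; rewrite !ffunE scale0r if_same mxE.
  - apply: entry_inj; rewrite -yc; apply/ffunP=> s; rewrite ffunE ffunE.
    have ys : mulchain A y s 0 0 = monomial_chain b c s by rewrite yc [RHS]ffunE.
    case: ifP => si; last first.
      rewrite mxE ffunE; have -> : c s = 0; last by rewrite scale0r if_same.
      by apply: contraFeq si => /ci ->.
    rewrite mxE ys ffunE; case: ifP => sb; last by rewrite linear0.
    rewrite linearZ /= (@degpart_homog _ _ _ _ (mdeg (b - mesym1 s)%MM)) ?dhomogX //.
    by rewrite add0n -(eqP si) mdeg_sub_mesym1 // bj eqxx.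
  exists (multipart b (entry (mulchain A w))).
    exact/supported_multipart/entry_mulchain_ideal.
  by rewrite -multipart_koszul koszul_entry wy -yc multipart_monomial_chain.
set z := entry (mulchain A y).
have zP s : monomial_ideal P (z s) by apply: entry_mulchain_ideal.
have zgr s k : (z s : S)@_k != 0 -> #|s| = i /\ (mdeg k + #|s|)%N = j.
  rewrite /z -gry ffunE ffunE; case: ifP => [/eqP->|]; last by rewrite mxE mcoeff0 eqxx.
  by rewrite mxE mcoeff_degpart add0n; case: (_ =P j) => [->|_]; rewrite ?eqxx.
have zb b : exists2 w, supported (face P b) w & bd w = multipart b z.
  have zbs s : multipart b z s != 0 -> #|s| = i /\ mdeg b = j.
    rewrite ffunE; case: ifP => [sb|]; last by rewrite eqxx.
    by move=> /zgr[]; rewrite mdeg_sub_mesym1.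
  have [bj|bj] := eqVneq (mdeg b) j.
    apply: (acyc b bj); first exact: supported_multipart.
      by move=> s /zbs[].
    by rewrite -multipart_koszul koszul_entry y0; apply/ffunP=> s;
       rewrite !ffunE mxE mcoeff0 if_same.
  exists 0; first by move=> s; rewrite ffunE eqxx.
  rewrite raddf0; apply/ffunP=> s; rewrite ffunE; apply/esym; apply/eqP.
  by apply: contraNT bj => /zbs[_ ->].
have [w wP wz] := koszul_boundary_monomial zb.
have [y' wy'] := entry_mulchain_lift wP.
by exists y'; apply: entry_inj; rewrite -koszul_entry -wy'.
Qed.

End MonomialResolution.

Section Regularity.
Variables (K : fieldType) (n : nat) (P : pred 'X_{1..n}).
Local Notation S := {mpoly K[n]}.
Variables (I : S -> Prop) (F : minimal_free_resolution I).
Hypothesis IP : forall p, I p <-> monomial_ideal P p.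

(** The resolution together with its augmentation to [S], which becomes the step
    0, so that all its maps are treated alike. *)
Definition aug_rank q := if q is q'.+1 then mfr_rank F q' else 1%N.

Definition aug_deg q : 'I_(aug_rank q) -> nat :=
  if q is q'.+1 then @mfr_deg _ _ _ F q' else fun=> 0%N.

Definition aug_mx q : 'M[S]_(aug_rank q.+1, aug_rank q) :=
  if q is q'.+1 then mfr_diff F q' else mfr_aug F.

Lemma aug_exact q (v : 'rV[S]_(aug_rank q.+1)) :
  v *m aug_mx q = 0 <-> exists w, v = w *m aug_mx q.+1.
Proof. by case: q v => [|q] v; [apply: mfr_exact0|apply: mfr_exact]. Qed.

Lemma aug_homog q s t : aug_mx q s t = 0 \/
  (aug_deg t <= aug_deg s)%N /\ aug_mx q s t \is (aug_deg s - aug_deg t)%N.-homog.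
Proof.
case: q s t => [|q] s t; last exact: mfr_diff_homog.
by right; split=> //; rewrite subn0 /= [t]ord1; apply: mfr_aug_homog.
Qed.

Lemma aug_minimal q s t : (aug_mx q.+1 s t)@_0%MM = 0.
Proof. exact: mfr_minimal. Qed.

Lemma aug_image p :
  monomial_ideal P p <-> exists v : 'rV[S]_(aug_rank 1), p = (v *m aug_mx 0) 0 0.
Proof. by rewrite -IP; apply: mfr_aug_image. Qed.

(** Both sides express the vanishing of [Tor_i(I, K)] in degree [j], computed from
    the resolution of [I] on the left and from that of [K] on the right. *)
Lemma betti_eq0P i j : betti F i j = 0%N <->
  (forall b, mdeg b = j -> acyclic K (face P b) i).
Proof.
rewrite -(koszul_vanishes_monomial aug_image).
split=> [/eqP|van].
  rewrite cards_eq0 => /eqP/setP noj.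
  apply: (koszul_vanishes_of_degrees aug_exact aug_homog) => r -> t.
  rewrite addn0 in t *.
  by have := noj t; rewrite !inE => /negbT.
apply/eqP; rewrite cards_eq0; apply/eqP/setP=> t; rewrite !inE; apply/negbTE.
apply: (degrees_of_koszul_vanishes aug_exact aug_homog aug_minimal van).
by rewrite addn0.
Qed.

End Regularity.

(** * Independent sets and gamma0 *)

Section Graph.
Variables (n : nat) (e : rel 'I_n).
Hypothesis (e_sym : ssrbool.symmetric e).
Implicit Types (A B C Y Z : {set 'I_n}) (x y z : 'I_n).

Lemma nbhP A y : reflect (exists2 x, x \in A & e x y) (y \in nbh e A).
Proof. by rewrite inE; apply: (iffP exists_inP). Qed.

Lemma independentP A :
  reflect (forall x y, x \in A -> y \in A -> ~~ e x y) (independent e A).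
Proof.
apply: (iffP forall_inP) => [indA x y /indA/forall_inP/(_ y)//|indA x xA].
by apply/forall_inP => y; apply: indA.
Qed.

Lemma nbhU A B : nbh e (A :|: B) = nbh e A :|: nbh e B.
Proof.
apply/setP=> y; rewrite in_setU; apply/nbhP/orP => [[x]|].
  by rewrite inE => /orP[] xA exy; [left|right]; apply/nbhP; exists x.
by case=> /nbhP[x xA exy]; exists x => //; rewrite inE xA ?orbT.
Qed.

Lemma card_disjointU A B : [disjoint A & B] -> #|A :|: B| = (#|A| + #|B|)%N.
Proof. by move=> dAB; apply/eqP; rewrite (leq_card_setU A B).2. Qed.

Lemma connect_last (r : rel 'I_n) x y :
  connect r x y -> x = y \/ exists2 z, connect r x z & r z y.
Proof.
case/connectP=> p; case/lastP: p => [|p z] /=; first by left.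
rewrite rcons_path last_rcons => /andP[xp rz] ->; right.
by exists (last x p) => //; apply/connectP; exists p.
Qed.

Lemma del_edge_connect_sym B : connect_sym (del_edge e B).
Proof.
by apply: sym_connect_sym => x y; rewrite /del_edge e_sym [(y \notin _) && _]andbC.
Qed.

Lemma del_component_notin B x y :
  x \notin B -> y \in del_component e B x -> y \notin B.
Proof.
by move=> xB; rewrite inE => /connect_last[<-//|[z _ /and3P[]]].
Qed.

Lemma del_component_nbr B x y :
  del_component e B x != [set x] -> y \in del_component e B x ->
  exists2 z, z \in del_component e B x & e z y.
Proof.
set C := del_component e B x => Cx.
have xC : x \in C by rewrite inE.
have step y' : y' \in C -> y' != x -> exists2 z, z \in C & e z y'.
  rewrite inE => /connect_last[->|[z xz /and3P[ezy' _ _]] _]; first by rewrite eqxx.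
  by exists z; rewrite ?inE.
move=> yC; have [yx|] := eqVneq y x; last exact: step.
have [y' y'C y'x] : exists2 y', y' \in C & y' != x.
  apply/exists_inP; apply: contraR Cx; rewrite negb_exists_in => /forall_inP Cx.
  by rewrite eqEsubset sub1set xC andbT; apply/subsetP=> z /Cx; rewrite negbK inE.
rewrite yx; move: (y'C); rewrite inE del_edge_connect_sym.
case/connect_last=> [y'x'|[z y'z /and3P[ezx _ _]]]; first by rewrite y'x' eqxx in y'x.
by exists z => //; rewrite inE; apply: connect_trans y'z; move: y'C; rewrite inE.
Qed.

(** The neighbours [Y2] of [Y1] lie outside [N(A)], so they are new in the
    neighbourhood of the union. *)
Lemma extend_independent A Y1 Y2 :
    independent e A -> independent e Y1 ->
    [disjoint Y1 & closed_nbh e A] -> [disjoint Y2 & closed_nbh e A] ->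
    Y2 \subset nbh e Y1 ->
  [/\ independent e (A :|: Y1), #|A :|: Y1| = (#|A| + #|Y1|)%N &
      (#|nbh e A| + #|Y2| <= #|nbh e (A :|: Y1)|)%N].
Proof.
move=> /independentP iA /independentP iY dY1 dY2 Y2N.
have nA y1 x : y1 \in Y1 -> x \in A -> ~~ e x y1.
  move=> yY xA; apply: contraL yY => exy; rewrite (disjointFl dY1) //.
  by rewrite inE; apply/orP; left; apply/nbhP; exists x.
split.
- apply/independentP=> x y; rewrite !inE => /orP[] xA /orP[] yA.
  + exact: iA.
  + exact: nA.
  + by rewrite e_sym; apply: nA.
  + exact: iY.
- rewrite card_disjointU // disjoint_sym.
  by apply: disjointWr dY1; apply: subsetUr.
rewrite nbhU -card_disjointU; first by apply: subset_leq_card; apply: setUS.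
by rewrite disjoint_sym; apply: disjointWr dY2; apply: subsetUl.
Qed.

(** A bipartite component with an edge, outside [N[A]], would allow a larger choice
    of [A]: each of its two sides is contained in the neighbourhood of the other
    one, and its smaller side can be added to [A]. *)
Lemma admissible_extension Z : independent e Z ->
  exists2 A, gamma0_admissible e A & (#|nbh e Z| + #|A| <= #|nbh e A| + #|Z|)%N.
Proof.
move=> iZ.
pose ok A := independent e A && (#|nbh e Z| + #|A| <= #|nbh e A| + #|Z|)%N.
have okZ : ok Z by rewrite /ok iZ leqnn.
have [A [iA leA maxA]] : exists A : {set 'I_n},
    [/\ independent e A, (#|nbh e Z| + #|A| <= #|nbh e A| + #|Z|)%N
      & forall A', ok A' -> (#|A'| <= #|A|)%N].
  by case: (@arg_maxnP _ Z ok (fun A => #|A|) okZ) => A /andP[iA leA] maxA; exists A.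
exists A => //; rewrite /gamma0_admissible iA /=.
apply/forall_inP=> x; rewrite inE => xA; apply/implyP=> bipC; apply: contraT => Cx.
set B := closed_nbh e A in xA bipC Cx *; set C := del_component e B x in bipC Cx.
have extend Y1 Y2 : independent e Y1 -> Y1 \subset C -> Y2 \subset C ->
    Y2 \subset nbh e Y1 -> Y1 != set0 -> (#|Y1| <= #|Y2|)%N -> false.
  move=> iY1 Y1C Y2C Y2N Y1n0 Y12.
  have dC Y : Y \subset C -> [disjoint Y & B].
    move=> YC; rewrite disjoints_subset; apply/subsetP=> y /(subsetP YC) yC.
    by rewrite inE; apply: del_component_notin yC.
  have [iAY cAY nAY] := extend_independent iA iY1 (dC _ Y1C) (dC _ Y2C) Y2N.
  have okAY : ok (A :|: Y1).
    rewrite /ok iAY cAY /= addnA; apply: leq_trans (leq_add leA Y12) _.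
    by rewrite addnAC leq_add2r.
  have := maxA _ okAY; rewrite cAY -[X in (_ <= X)%N]addn0 leq_add2l.
  by rewrite leqn0 cards_eq0 (negPf Y1n0).
have [X /forall_inP bipX] := existsP bipC.
have bip y z : y \in C -> z \in C -> e y z -> (y \in X) != (z \in X).
  by move=> /bipX/forall_inP bipy /bipy/implyP.
have nbr y : y \in C -> exists2 z, z \in C & e z y by apply: del_component_nbr.
have iY (Y : {set 'I_n}) b : (forall y, y \in Y -> y \in C /\ (y \in X) = b) ->
   independent e Y.
  move=> YX; apply/independentP=> y z /YX[yC yX] /YX[zC zX].
  by apply/negP=> /(bip _ _ yC zC); rewrite yX zX eqxx.
have xC : x \in C by rewrite inE.
pose Y1 := C :&: X; pose Y2 := C :\: X.
have iY1 : independent e Y1 by apply: (iY _ true) => y /setIP[].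
have iY2 : independent e Y2.
  by apply: (iY _ false) => y /setDP[yC /negPf].
have Y12 : Y2 \subset nbh e Y1.
  apply/subsetP=> y /setDP[yC yX]; have [z zC ezy] := nbr y yC.
  apply/nbhP; exists z => //; rewrite inE zC /=.
  by have := bip _ _ zC yC ezy; rewrite (negPf yX); case: (z \in X).
have Y21 : Y1 \subset nbh e Y2.
  apply/subsetP=> y /setIP[yC yX]; have [z zC ezy] := nbr y yC.
  apply/nbhP; exists z => //; rewrite inE zC andbT.
  by have := bip _ _ zC yC ezy; rewrite yX; case: (z \in X).
have [Y1n0 Y2n0] : Y1 != set0 /\ Y2 != set0.
  have xY : (x \in Y1) || (x \in Y2) by rewrite in_setI in_setD xC; case: (x \in X).
  case/orP: xY => xY; split; apply/set0Pn; first by exists x.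
  - by case/nbhP: (subsetP Y21 _ xY) => z zY _; exists z.
  - by case/nbhP: (subsetP Y12 _ xY) => z zY _; exists z.
  - by exists x.
have [le12|lt21] := leqP #|Y1| #|Y2|.
  by apply: (extend Y1 Y2) => //; [apply: subsetIl|apply: subsetDl].
by apply: (extend Y2 Y1) => //; [apply: subsetDl|apply: subsetIl|apply: ltnW].
Qed.

Lemma gamma0_ge Z : independent e Z ->
  (n%:R + #|nbh e Z|%:R - #|Z|%:R : rat) <= 2%:R * gamma0 e.
Proof.
move=> /admissible_extension[A admA leA].
rewrite -ler_pdivrMl ?ltr0n // mulrC /gamma0 (bigD1 A) //= le_max.
apply/orP; left; rewrite ler_pM2r ?invr_gt0 ?ltr0n //.
rewrite -(ler_nat rat) !natrD in leA; lra.
Qed.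

End Graph.

(** * Symbolic powers of cover ideals *)

Lemma leq_succ_pair k a b (p q : bool) : (p -> 0 < a)%N -> (q -> 0 < b)%N ->
  (k - 2 <= (a - p) + (b - q) -> k <= (a.+1 - p) + (b.+1 - q))%N.
Proof. by case: p => [/(_ isT) a0|_]; case: q => [/(_ isT) b0|_]; lia. Qed.

Lemma leq_pred_pair k a b (p q : bool) :
  (k <= (a.+1 - p) + (b.+1 - q) -> k - 2 <= (a - p) + (b - q))%N.
Proof. by case: p; case: q; lia. Qed.

Section CoverIdeal.
Variables (n : nat) (e : rel 'I_n).
Implicit Types (b m : 'X_{1..n}) (s L Z : {set 'I_n}) (x y v : 'I_n).

Definition cover_monomial k m := [forall x, forall y, e x y ==> (k <= m x + m y)%N].

Lemma cover_monomialP k m :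
  reflect (forall x y, e x y -> (k <= m x + m y)%N) (cover_monomial k m).
Proof.
apply: (iffP forallP) => [h x y exy|h x]; last by apply/forallP=> y; apply/implyP/h.
by have /forallP/(_ y)/implyP := h x; apply.
Qed.

Lemma mcoeffM_neq0 (K : fieldType) (p q : {mpoly K[n]}) m : (p * q)@_m != 0 ->
  exists m1 m2, [/\ m = (m1 + m2)%MM, p@_m1 != 0 & q@_m2 != 0].
Proof.
rewrite -mcoeff_msupp => /msuppM_le/allpairsP[[m1 m2] /= [m1p m2q ->]].
by exists m1, m2; rewrite -!mcoeff_msupp.
Qed.

(** The powers of the prime [(x, y)] are monomial ideals. In the direction from the
    right, every monomial is divided by one of the two variables that occurs in
    it, and the quotient is in the preceding power. *)
Lemma ideal_exp_edgeP (K : fieldType) k x y (p : {mpoly K[n]}) : x != y ->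
  ideal_exp (ideal2 'X_x 'X_y) k p <->
  monomial_ideal (fun m => k <= m x + m y)%N p.
Proof.
move=> xy; have yx : (y == x) = false by rewrite eq_sym (negPf xy).
split.
  elim: k p => [|k IHk] p //= [us [us_in ->]] m; apply: contraR => km.
  rewrite raddf_sum big_seq big1 // => u /us_in[[c [d uE]] /IHk u2k] /=.
  have vanish v q : (v == x) || (v == y) -> ('X_v * (q * u.2))@_m = 0.
    move=> vxy; rewrite mcoeffXM; case: ifP => // /mnm_lepP vm.
    apply: contraNeq km => /mcoeffM_neq0[m1 [m2 [/mnmP mE _ /u2k kw]]].
    move: (mE x) (mE y) (vm x) (vm y) kw; rewrite !mnmBE !mnmDE !mnm1E.
    by case/orP: vxy => /eqP->; rewrite eqxx ?yx ?(negPf xy); lia.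
  rewrite uE mulrDl mcoeffD -!mulrA mulrCA vanish ?eqxx // add0r.
  by rewrite mulrCA vanish ?eqxx ?orbT.
elim: k p => [//|k IHk] p pk /=.
pose g m := if (0 < m x)%N then x else y.
have gm m : p@_m != 0 -> (U_(g m) <= m)%MM.
  move=> /pk km; apply/mnm_lepP=> v; rewrite mnm1E /g.
  by case: ifP => mx; case: eqP => // <-; move: mx km => /=; lia.
exists [seq ('X_(g m), p@_m *: 'X_[m - U_(g m)]) | m <- msupp p]; split.
  move=> _ /mapP[m mp ->] /=; rewrite mcoeff_msupp in mp; split.
    rewrite /g; case: ifP => _; [exists 1, 0|exists 0, 1];
    by rewrite mul1r mul0r ?addr0 ?add0r.
  apply: IHk => m'; rewrite mcoeffZ mcoeffX.
  case: (_ =P m') => [<- _|_]; last by rewrite mulr0 eqxx.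
  have := pk m mp; rewrite !mnmBE !mnm1E /g.
  by case: ifP; rewrite eqxx ?yx ?(negPf xy); lia.
rewrite big_map {1}[p]mpolyE; apply: eq_big_seq => m /=; rewrite mcoeff_msupp => /gm mg.
by rewrite -scalerAr -mpolyXD addmC submK.
Qed.

Lemma cover_symbolic_powerP (K : fieldType) k p : irreflexive e ->
  cover_symbolic_power K e k p <-> monomial_ideal (cover_monomial k) p.
Proof.
move=> irr; split=> [pk m pm|pk x y exy].
  apply/cover_monomialP=> x y exy.
  have xy : x != y by apply: contraTneq exy => ->; rewrite irr.
  by have /(ideal_exp_edgeP _ _ xy) := pk x y exy; apply.
have xy : x != y by apply: contraTneq exy => ->; rewrite irr.
by apply/(ideal_exp_edgeP _ _ xy) => m /pk/cover_monomialP/(_ x y exy).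
Qed.

Lemma face_coverP k b s :
  reflect ((forall v, v \in s -> (0 < b v)%N) /\
           (forall x y, e x y -> (k <= (b x - (x \in s)) + (b y - (y \in s)))%N))
          (face (cover_monomial k) b s).
Proof.
apply: (iffP andP) => -[h1 h2]; split.
- by move=> v vs; move/mnm_lepP/(_ v): h1; rewrite mnmE vs.
- by move=> x y exy; move/cover_monomialP/(_ x y exy): h2; rewrite !mnmE.
- by apply/mnm_lepP=> v; rewrite mnmE; case: (boolP (v \in s)) => // /h1.
by apply/cover_monomialP=> x y exy; rewrite !mnmE; apply: h2.
Qed.

Hypothesis e_sym : ssrbool.symmetric e.
Variable K : fieldType.

(** The core of the proof: up to cones and empty families, the families of
    [J(G)^(k)] arise from those of [J(G)^(k-2)]. *)
Lemma cover_face_acyclic k (r' : int) b i : (2 <= k)%N ->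
  (forall c j, r' < (mdeg c)%:Z - j%:Z -> acyclic K (face (cover_monomial (k - 2)) c) j) ->
  (forall Z, independent e Z ->
     n%:Z + #|nbh e Z|%:Z - #|Z|%:Z + r' < (mdeg b)%:Z - i%:Z) ->
  acyclic K (face (cover_monomial k) b) i.
Proof.
move=> k2 acyc bound.
pose U := [set v | b v == 1%N].
apply: (@acyclic_split _ _ U) => [v s /face_coverP[h1 h2]|L j LU ij].
  apply/face_coverP; split=> [x xs|x y exy]; first by apply: h1; rewrite inE xs orbT.
  by apply: leq_trans (h2 x y exy) _; apply: leq_add; apply: leq_sub2l;
     rewrite inE; case: (_ \in s); rewrite ?orbT.
have LU1 v : v \in L -> b v = 1%N by move=> /(subsetP LU); rewrite inE => /eqP.
set T := fun s => _.
have TP s : reflect ((forall v, v \in s -> (1 < b v)%N) /\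
    (forall x y, e x y -> (k <= (b x - ((x \in L) || (x \in s))) +
                              (b y - ((y \in L) || (y \in s))))%N)) (T s).
  apply: (iffP andP) => [[dsU /face_coverP[h1 h2]]|[h1 h2]].
    split=> [v vs|x y /h2]; last by rewrite !inE.
    have /h1 : v \in L :|: s by rewrite inE vs orbT.
    by have := disjointFr dsU vs; rewrite inE; case: (b v) => [|[]].
  split.
    rewrite disjoints_subset; apply/subsetP=> v /h1; rewrite !inE.
    by case: (b v) => [|[]].
  apply/face_coverP; split=> [v|x y /h2]; last by rewrite !inE.
  by rewrite inE => /orP[/LU1->//|/h1/ltnW].
clearbody T.
(* The vertices where [x^b], divided by the variables in [L], has exponent 0. *)
pose Z := [set v | b v == 0%N] :|: L.
have bZ v : v \in Z -> (b v - (v \in L) = 0)%N.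
  by rewrite !inE => /orP[/eqP->//|vL]; rewrite vL LU1.
have Z0 s x : x \in Z -> (b x - ((x \in L) || (x \in s)) = 0)%N.
  by move=> /bZ; case: (x \in L); case: (x \in s) => /=; lia.
(* No face exists, so the family is vacuously a cone over any vertex. *)
have emptyT x y : x \in Z -> e x y -> (b y - (y \in L) < k)%N -> acyclic K T j.
  move=> xZ exy yk; apply: (@acyclic_cone _ _ _ x) => s Ts.
  have /TP[_ /(_ x y exy)] := Ts; rewrite (Z0 s) // add0n.
  by case: (y \in L) yk => /=; lia.
have [iZ|] := boolP (independent e Z); last first.
  case/forall_inPn=> x xZ /forall_inPn[y yZ]; rewrite negbK => exy.
  by apply: (emptyT x y) => //; rewrite bZ //; lia.
have dZ v : v \in nbh e Z -> v \in Z = false.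
  by case/nbhP=> x xZ exv; apply: contraTF exv => vZ; apply: (independentP _ _ iZ).
have nL v : v \in nbh e Z -> v \in L = false.
  by move/dZ; rewrite !inE => /norP[_ /negPf].
(* A neighbour [y] of [Z] with [b y < k] violates its edge to [Z]; if [b y > k],
   all the edges at [y] hold whether or not [y] belongs to the set. *)
have [/forall_inP bN|] := boolP [forall v in nbh e Z, b v == k]; last first.
  case/forall_inPn=> y yN byk; have /nbhP[x xZ exy] := yN.
  have [lt_by|le_by] := ltnP (b y) k.
    by apply: (emptyT x y) => //; rewrite nL // subn0.
  apply: (@acyclic_cone _ _ _ y) => s /TP[h1 h2]; apply/TP; split=> [v|u v euv].
    by rewrite !inE => /predU1P[->|/h1//]; apply: leq_trans k2 le_by.
  have kby : (k <= b y - 1)%N by move: byk le_by; rewrite neq_ltn; lia.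
  have [->|uy] := eqVneq u y.
    by rewrite nL // in_setU1 eqxx /=; apply: leq_trans kby (leq_addr _ _).
  have [->|vy] := eqVneq v y.
    by rewrite (nL y) // (in_setU1 y) eqxx /=; apply: leq_trans kby (leq_addl _ _).
  by rewrite !in_setU1 (negPf uy) (negPf vy); apply: h2.
(* Faces avoid [N(Z)], where the condition of the edges to [Z] is tight; the edges
   inside the rest of the graph lose 1 at both ends. *)
pose c := [multinom if v \in Z then 0%N else
   if v \in nbh e Z then (k - 2)%N else (b v).-1 | v < n].
have cE v : c v = if v \in Z then 0%N else
   if v \in nbh e Z then (k - 2)%N else (b v).-1 by rewrite mnmE.
(* Summed over all vertices, this compares the degrees of [b] and [c]; the
   membership of [Z] on the left avoids a truncated subtraction. *)
have bE v : (b v + (v \in Z) = c v + (v \in L) + 1 + (v \in nbh e Z))%N.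
  rewrite cE; have [vN|vN] := boolP (v \in nbh e Z).
    by rewrite dZ // nL // (eqP (bN v vN)); lia.
  rewrite !inE; case: (boolP (v \in L)) => [/LU1->|vL]; first by rewrite orbT.
  by rewrite orbF; case: eqP => [->//|]; lia.
have cZ v : v \in Z -> c v = 0%N by move=> vZ; rewrite cE vZ.
have cN v : v \in nbh e Z -> c v = (k - 2)%N by move=> vN; rewrite cE dZ ?vN.
have cW v : v \notin Z -> v \notin nbh e Z -> [/\ b v = (c v).+1 & v \in L = false].
  move=> vZ vN; rewrite cE (negPf vZ) (negPf vN).
  by move: vZ; rewrite !inE => /norP[vb /negPf vL]; rewrite vL prednK ?lt0n.
have edge x y (Q : Prop) : e x y -> (x \in nbh e Z -> Q) -> (y \in nbh e Z -> Q) ->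
    (x \notin Z -> x \notin nbh e Z -> y \notin Z -> y \notin nbh e Z -> Q) -> Q.
  move=> exy Qx Qy Qxy; have [/Qx//|xN] := boolP (x \in nbh e Z).
  have [/Qy//|yN] := boolP (y \in nbh e Z); apply: Qxy => //.
    by apply: contra yN => xZ; apply/nbhP; exists x.
  by apply: contra xN => yZ; apply/nbhP; exists y; rewrite // e_sym.
apply: (@eq_acyclic _ _ (face (cover_monomial (k - 2)) c)) => [s|].
  apply/face_coverP/TP => -[h1 h2].
    have sN v : v \in nbh e Z -> v \in s = false.
      move=> vN; have /nbhP[x xZ exv] := vN; apply/negP=> vs.
      by move: (h2 x v exv) (h1 v vs); rewrite (cZ x) // cN // vs /=; lia.
    split=> [v vs|x y exy].
      have vZ : v \notin Z by apply: contraTN (h1 v vs) => /cZ ->.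
      have vN : v \notin nbh e Z by apply: contraTN vs => /sN ->.
      by have [-> _] := cW v vZ vN; rewrite ltnS h1.
    apply: (edge x y _ exy) => [xN|yN|xZ xN yZ yN].
    - by rewrite nL // sN // (eqP (bN x xN)) subn0 leq_addr.
    - by rewrite (nL y) // (sN y) // (eqP (bN y yN)) subn0 leq_addl.
    have [-> ->] := cW x xZ xN; have [-> ->] := cW y yZ yN.
    by apply: leq_succ_pair (h2 x y exy); apply: h1.
  have sN v : v \in nbh e Z -> v \in s = false.
    move=> vN; have /nbhP[x xZ exv] := vN; apply/negP=> vs.
    move: (h2 x v exv); rewrite (Z0 s) // vs orbT (eqP (bN v vN)) /=; lia.
  split=> [v vs|x y exy].
    have vN : v \notin nbh e Z by apply: contraTN vs => /sN ->.
    have vZ : v \notin Z.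
      apply: contraTN (h1 v vs); rewrite !inE => /orP[/eqP->//|/LU1->//].
    by have [bv _] := cW v vZ vN; have := h1 v vs; rewrite bv.
  apply: (edge x y _ exy) => [xN|yN|xZ xN yZ yN].
  - by rewrite cN // sN // subn0 leq_addr.
  - by rewrite (cN y) // (sN y) // subn0 leq_addl.
  have [bx Lx] := cW x xZ xN; have [b_y Ly] := cW y yZ yN.
  by have := h2 x y exy; rewrite bx b_y Lx Ly; apply: leq_pred_pair.
apply: acyc; have := bound Z iZ.
have : (mdeg b + #|Z| = mdeg c + #|L| + n + #|nbh e Z|)%N.
  have sumE (B : {set 'I_n}) : #|B| = (\sum_v (v \in B))%N.
    by rewrite -sum1_card big_mkcond; apply: eq_bigr => v _; case: (v \in B).
  have nE : (\sum_(v < n) 1 = n)%N by rewrite sum_nat_const card_ord muln1.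
  rewrite !mdegE !sumE -big_split (eq_bigr _ (fun v _ => bE v)).
  by rewrite !big_split /= nE.
move: #|Z| #|nbh e Z| (mdeg b) (mdeg c) => z N B C; clear -ij; rewrite ij; lia.
Qed.

End CoverIdeal.

Theorem theorem4p7 (K : fieldType) (n : nat) (e : rel 'I_n)
    (e_sym : ssrbool.symmetric e) (e_irr : irreflexive e)
    (k : nat) (hk : (2 <= k)%N) (r r' : int)
    (hr : has_regularity (cover_symbolic_power K e k) r)
    (hr' : has_regularity (cover_symbolic_power K e (k - 2)) r') :
  (r%:~R : rat) <= 2%:R * gamma0 e + r'%:~R.
Proof.
have [F [[i [j [/eqP betti_ij ->]]] _]] := hr.
have [F' [_ betti_le]] := hr'.
rewrite leNgt; apply/negP=> lt_ij; apply: betti_ij.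
apply/(betti_eq0P _ (fun p => cover_symbolic_powerP k p e_irr)) => b bj.
apply: (@cover_face_acyclic _ _ e_sym K _ r' _ _ hk) => [c q lt_cq|Z indZ].
  apply: (betti_eq0P _ (fun p => cover_symbolic_powerP _ p e_irr) q (mdeg c)).1 => //.
  by apply/eqP; case: eqP => // /eqP/betti_le; rewrite leNgt lt_cq.
rewrite bj -(ltr_int rat); apply: le_lt_trans lt_ij.
by rewrite intrD lerD2r intrB intrD; apply: gamma0_ge.
Qed.
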